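(* Let $G$ be a graph of order $n$ with maximum degree $\Delta=\Delta(G)$, and let $k$ be an integer with $\Delta\ge k\ge 1$. Then $$L_k(G)\ \ge\ \frac{k\,n}{\binom{\Delta+1}{k+1}^{1/k}\,(1+k)^{1+1/k}}.$$
   Context: All graphs are finite, simple and undirected. For a vertex $v$, $N[v]$ denotes the closed neighbourhood of $v$ (i.e., $v$ together with its neighbours). A vertex set $X\subseteq V(G)$ is a $k$-limited packing if $|N[v]\cap X|\le k$ for every $v\in V(G)$. The $k$-limited packing number $L_k(G)$ is the maximum size of a $k$-limited packing in $G$. $\Delta(G)$ is the maximum vertex degree of $G$. *)

(* Defs.v *)
From mathcomp Require Import all_boot all_order all_algebra.
From mathcomp Require Import reals exp.

Set Implicit Arguments.
Unset Strict Implicit.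
Unset Printing Implicit Defensive.

(* A finite simple graph on the vertex set T is given by its adjacency relation
   e : rel T, assumed symmetric and irreflexive wherever it matters. *)

Definition open_nbhd (T : finType) (e : rel T) (v : T) : {set T} :=
  [set w | e v w].

Definition closed_nbhd (T : finType) (e : rel T) (v : T) : {set T} :=
  v |: open_nbhd e v.

Definition max_degree (T : finType) (e : rel T) : nat :=
  \max_(v : T) #|open_nbhd e v|.

Definition limited_packing (T : finType) (e : rel T) (k : nat) (X : {set T}) :
    bool :=
  [forall v : T, #|closed_nbhd e v :&: X| <= k].

(* set0 is always a k-limited packing, so this maximum is attained. *)
Definition limited_packing_number (T : finType) (e : rel T) (k : nat) : nat :=
  \max_(X : {set T} | limited_packing e k X) #|X|.

(* Main.v *)
(** Keep each vertex independently with probability [p], then delete one vertex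
    from every surviving [k.+1]-subset of a closed neighbourhood.  The expected
    number of vertices left is at least [n p - n 'C(Delta.+1, k.+1) p^(k+1)],
    and [p = ('C(Delta.+1, k.+1) (k+1))^(-1/k)] maximises this bound. *)
Require Import Defs.
From mathcomp Require Import all_boot all_order all_algebra.
From mathcomp Require Import reals exp.
From mathcomp Require Import ring.

Set Implicit Arguments.
Unset Strict Implicit.
Unset Printing Implicit Defensive.

Import Order.TTheory GRing.Theory Num.Theory.
Local Open Scope ring_scope.

Definition bernoulli_weight (R : pzRingType) (T : finType) (p : R)
    (A : {set T}) : R :=
  \prod_(x : T) (if x \in A then p else 1 - p).

Lemma bernoulli_weight_ge0 (R : numDomainType) (T : finType) (p : R)
    (A : {set T}) : 0 <= p <= 1 -> 0 <= bernoulli_weight p A.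
Proof.
case/andP=> p0 p1; apply: prodr_ge0 => x _.
by case: ifP => _ //; rewrite subr_ge0.
Qed.

Lemma sum_bernoulli_weight_supset (R : comPzRingType) (T : finType) (p : R)
    (S : {set T}) :
  \sum_(A : {set T}) bernoulli_weight p A * (S \subset A)%:R = p ^+ #|S|.
Proof.
(* [G x] is the factor for leaving [x] out, set to 0 on [S]: expanding the product of [p + G x] over
   all [A] then kills exactly the sets [A] that miss a point of [S]. *)
pose G x := if x \in S then 0 else 1 - p.
transitivity (\prod_(x : T) (p + G x)).
  rewrite bigA_distr; apply: eq_bigr => A _; rewrite /bernoulli_weight.
  case: (boolP (S \subset A)) => [SA|/subsetPn[x xS xA]].
    rewrite mulr1; apply: eq_bigr => x _; case: ifPn => // xA.
    by rewrite /G ifN //; apply: contra xA => /(subsetP SA).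
  by rewrite mulr0 (bigD1 x) //= (negbTE xA) /G xS mul0r.
rewrite (bigID (mem S)) /= [X in _ * X]big1 ?mulr1 => [|x /negbTE xS].
  rewrite (eq_bigr (fun=> p)) ?prodr_const // => x xS.
  by rewrite /G xS addr0.
by rewrite /G xS addrC subrK.
Qed.

(** First-moment principle. If every [f i] were below the average [c], the nonnegative terms
    [w i * (c - f i)] would sum to 0, forcing all weights to vanish against their total of 1. *)
Lemma weighted_average_le (R : realDomainType) (I : finType) (w f : I -> R) :
  (forall i, 0 <= w i) -> \sum_i w i = 1 ->
  exists i, \sum_j w j * f j <= f i.
Proof.
move=> w0 w1; set c := \sum_j _.
have [/existsP//|/existsPn none] := boolP [exists i, c <= f i].
have cf i : f i < c by rewrite ltNge.
have s0 : \sum_i w i * (c - f i) = 0.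
  under eq_bigr do rewrite mulrBr.
  by rewrite big_split /= sumrN -mulr_suml w1 mul1r subrr.
have t0 i : 0 <= w i * (c - f i) by rewrite mulr_ge0 // subr_ge0 ltW.
have wz i : w i = 0.
  have /eqP := psumr_eq0P (fun i _ => t0 i) s0 (erefl : xpredT i).
  by rewrite mulf_eq0 subr_eq0 (gt_eqF (cf i)) orbF => /eqP.
by move: w1; rewrite big1 // => /eqP; rewrite eq_sym oner_eq0.
Qed.

(** The deletion step: removing one chosen point of each member of [F] inside [A] destroys all of
    them, at a cost of at most one point per member. *)
Lemma independent_subset (T : finType) (F : {set {set T}}) (A : {set T}) :
  set0 \notin F ->
  exists2 X : {set T}, forall S, S \in F -> ~~ (S \subset X) &
    (#|A| <= #|X| + #|[set S in F | S \subset A]|)%N.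
Proof.
move=> F0; set B := [set S in F | S \subset A].
have [B0|[S0]] := set_0Vmem B.
  exists A; last by rewrite leq_addr.
  move=> S SF; apply/negP => SA; suff : S \in B by rewrite B0 inE.
  by rewrite inE SF.
rewrite inE => /andP[S0F _].
have /set0Pn[x0 _] : S0 != set0 by apply: contraNneq F0 => <-.
(* The default [x0] is never the fallback on a member of [F], all of which are nonempty; the case
   split on [B] serves to have some point of [T] at hand. *)
pose c (S : {set T}) := odflt x0 [pick x in S].
have cP S : S \in F -> c S \in S.
  move=> SF; rewrite /c; case: pickP => //= S_empty.
  by case/negP: F0; suff <- : S = set0 by []; apply/setP => x; rewrite inE S_empty.
exists (A :\: c @: B).
  move=> S SF; apply/negP; rewrite subsetD => /andP[SA disj].
  by have := disjointFr disj (cP _ SF); rewrite imset_f // inE SF.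
rewrite -(cardsID (c @: B) A) addnC leq_add2l.
exact: leq_trans (subset_leq_card (subsetIr _ _)) (leq_imset_card _ _).
Qed.

Lemma uniform_hypergraph_independent (R : realDomainType) (T : finType)
    (F : {set {set T}}) (m : nat) (p : R) :
  (forall S, S \in F -> #|S| = m.+1) -> 0 <= p <= 1 ->
  exists2 X : {set T}, forall S, S \in F -> ~~ (S \subset X) &
    #|T|%:R * p - #|F|%:R * p ^+ m.+1 <= #|X|%:R.
Proof.
move=> Fm p01.
have w1 : \sum_(A : {set T}) bernoulli_weight p A = 1.
  (* The total weight is the case [S = set0] of the superset formula. *)
  rewrite -[RHS](expr0 p) -(cards0 T) -sum_bernoulli_weight_supset.
  by apply: eq_bigr => A _; rewrite sub0set mulr1.
pose f (A : {set T}) : R := #|A|%:R - #|[set S in F | S \subset A]|%:R.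
have [A] := weighted_average_le f (fun A => bernoulli_weight_ge0 A p01) w1.
(* Both cardinals become sums of containment indicators, with singletons standing for vertices, so
   one superset formula evaluates both expectations. *)
have fE (A' : {set T}) : f A' = \sum_(x : T) ([set x] \subset A')%:R
     - \sum_(S in F) (S \subset A')%:R.
  rewrite /f -!natr_sum -!sum1_card; congr (_%:R - _%:R).
    by rewrite big_mkcond; apply: eq_bigr => x _; rewrite sub1set; case: (x \in _).
  rewrite big_mkcond [RHS]big_mkcond; apply: eq_bigr => S _; rewrite inE.
  by case: (S \in F) => //=; case: (S \subset A').
have -> : \sum_(A' : {set T}) bernoulli_weight p A' * f A' =
    #|T|%:R * p - #|F|%:R * p ^+ m.+1.
  under eq_bigr do rewrite fE mulrBr !mulr_sumr.
  rewrite sumrB exchange_big [X in _ - X]exchange_big /=; congr (_ - _).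
    under eq_bigr do rewrite sum_bernoulli_weight_supset cards1 expr1.
    by rewrite sumr_const mulr_natl.
  rewrite (eq_bigr (fun=> p ^+ m.+1)) ?sumr_const ?mulr_natl // => S SF.
  by rewrite sum_bernoulli_weight_supset Fm.
move=> le_f; have F0 : set0 \notin F.
  by apply/negP => /Fm; rewrite cards0.
have [X indX leX] := independent_subset A F0; exists X => //.
by apply: le_trans le_f _; rewrite /f lerBlDr -natrD ler_nat.
Qed.

Definition closed_nbhd_subsets (T : finType) (e : rel T) (m : nat) :
    {set {set T}} :=
  \bigcup_(v : T) [set S : {set T} | S \subset closed_nbhd e v & #|S| == m].

Lemma card_closed_nbhd_subsets (T : finType) (e : rel T) (m : nat) :
  (#|closed_nbhd_subsets e m| <= #|T| * 'C((max_degree e).+1, m))%N.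
Proof.
rewrite -sum_nat_const /closed_nbhd_subsets.
elim/big_rec2: _ => [|v N U _ leUN]; first by rewrite cards0.
apply: leq_trans (leq_card_setU _ _) (leq_add _ leUN).
rewrite cards_draws; apply: leq_bin2l.
rewrite cardsU1 -add1n leq_add ?leq_b1 //.
exact: (leq_bigmax (F := fun v => #|open_nbhd e v|)).
Qed.

(** A closed neighbourhood meeting [X] in more than [k] vertices would yield a [k.+1]-subset inside
    [X]; the positive binomial coefficient supplies one. *)
Lemma limited_packing_of_independent (T : finType) (e : rel T) (k : nat)
    (X : {set T}) :
  (forall S, S \in closed_nbhd_subsets e k.+1 -> ~~ (S \subset X)) ->
  limited_packing e k X.
Proof.
move=> indX; apply/forallP => v; rewrite leqNgt; apply/negP => gtk.
have : (0 < #|[set S : {set T} | S \subset closed_nbhd e v :&: X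
                               & #|S| == k.+1]|)%N.
  by rewrite cards_draws bin_gt0.
case/card_gt0P=> S; rewrite inE subsetI => /andP[/andP[Sv SX] cS].
suff /indX/negP : S \in closed_nbhd_subsets e k.+1 by [].
by apply/bigcupP; exists v => //; rewrite inE Sv.
Qed.

Lemma limited_packing_number_ge (R : realDomainType) (T : finType) (e : rel T)
    (k : nat) (p : R) : 0 <= p <= 1 ->
  #|T|%:R * p - #|T|%:R * 'C((max_degree e).+1, k.+1)%:R * p ^+ k.+1
    <= (limited_packing_number e k)%:R.
Proof.
move=> p01; have [S|X indX leX] :=
    @uniform_hypergraph_independent R T (closed_nbhd_subsets e k.+1) k p _ p01.
  by case/bigcupP=> v _; rewrite inE => /andP[_ /eqP].
have leL : (#|X| <= limited_packing_number e k)%N.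
  by apply: leq_bigmax_cond; apply: limited_packing_of_independent.
apply: le_trans (le_trans leX _); last by rewrite ler_nat.
rewrite lerD2l lerN2 ler_wpM2r ?exprn_ge0 //; first by case/andP: p01.
by rewrite -natrM ler_nat card_closed_nbhd_subsets.
Qed.

Theorem theorem1 (R : realType) (T : finType) (e : rel T)
    (e_sym : symmetric e) (e_irr : irreflexive e)
    (n Delta k : nat) (n_order : n = #|T|) (Delta_max : Delta = max_degree e)
    (k_ge1 : (1 <= k)%N) (k_leDelta : (k <= Delta)%N) :
  (limited_packing_number e k)%:R >=
    (k%:R * n%:R) /
    ('C(Delta.+1, k.+1)%:R `^ (1 / k%:R) * (1 + k%:R) `^ (1 + 1 / k%:R)) :> R.
Proof.
subst n Delta; set b : R := 'C(_, _)%:R; set K : R := k%:R.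
(* Here [k <= Delta] enters: it makes the binomial positive, whence [q >= 1] and [q^-1] is a
   probability. *)
have b1 : 1 <= b by rewrite ler1n bin_gt0.
have b0 : 0 < b := lt_le_trans ltr01 b1.
have K0 : 0 < K by rewrite ltr0n.
have K1 : 0 < 1 + K by rewrite addr_gt0.
(* [q] is the reciprocal of the optimal probability. *)
pose q := (b * (1 + K)) `^ (1 / K).
have bK1 : 1 <= b * (1 + K) by rewrite mulr_ege1 // lerDl ltW.
have q1 : 1 <= q.
  by rewrite -[X in X <= _](powRr0 (b * (1 + K))) ler_powR // divr_ge0 // ltW.
have q0 : 0 < q := lt_le_trans ltr01 q1.
have qk : q ^+ k = b * (1 + K).
  rewrite -powR_mulrn ?ltW // /q -powRrM divfK ?gt_eqF // powRr1 //.
  exact: le_trans ler01 bK1.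
have p01 : 0 <= q^-1 <= 1 by rewrite invr_ge0 invf_le1 // (ltW q0).
apply: le_trans (limited_packing_number_ge e k p01).
(* Since [q ^+ k = b * (1 + K)], the subtracted term is [n / (q * (1 + K))], leaving
   [n * K / (q * (1 + K))]. The target denominator also factors as [q * (1 + K)], so the two sides
   are equal. *)
rewrite -/b exprVn exprS qk powRD; last by rewrite (gt_eqF K1) implybT.
rewrite powRr1 ?(ltW K1) // mulrCA -powRM ?(ltW b0) ?(ltW K1) // -/q.
rewrite le_eqVlt; apply/orP; left; apply/eqP; field.
by rewrite !gt_eqF.
Qed.
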